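(* Let $\Bbbk$ be an infinite field, $\mathcal{P}=\Bbbk[x_1,\dots,x_n]$, let $\mathcal{I}\unlhd\mathcal{P}$ be a homogeneous ideal of dimension $D$, and put $\mathcal{R}=\mathcal{P}/\mathcal{I}$. Then the reduction number set $\mathrm{rSet}(\mathcal{R})$ is finite.
   Context: The dimension of $\mathcal{I}$ is $D=\dim\mathcal{I}$, the Krull dimension of $\mathcal{P}/\mathcal{I}$ (with $\mathcal{I}$ proper). Let $y_1,\dots,y_D\in\mathcal{P}_1$ be $D$ linear forms defining a Noether normalisation of $\mathcal{R}$, i.e. $\Bbbk[y_1,\dots,y_D]\to\mathcal{R}$ is injective (with the $y_i$ algebraically independent) and $\mathcal{R}$ is a finite module over it; equivalently, $\mathcal{I}+\langle y_1,\dots,y_D\rangle$ is a zero-dimensional ideal. Then $\mathcal{J}=\mathcal{I}+\langle y_1,\dots,y_D\rangle$ is called a minimal reduction of $\mathcal{I}$, and the reduction number $r_{\mathcal{J}}(\mathcal{R})$ with respect to $\mathcal{J}$ is the largest degree $q$ with $(\mathcal{P}/\mathcal{J})_q\neq0$. The reduction number set is $\mathrm{rSet}(\mathcal{R})=\{r_{\mathcal{J}}(\mathcal{R})\mid\mathcal{J}\text{ a minimal reduction of }\mathcal{I}\}$. *)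

(* Defs.v *)
From HB Require Import structures.
From mathcomp Require Import all_boot all_order all_algebra.
From mathcomp Require Import boolp classical_sets cardinality.
From mathcomp Require Import mpoly.

Set Implicit Arguments.
Unset Strict Implicit.
Unset Printing Implicit Defensive.

Import GRing.Theory.
Local Open Scope ring_scope.
Local Open Scope quotient_scope.
Local Open Scope classical_set_scope.

(* MathComp's idealr and prime_idealr are proper ideals, given by boolean
   predicates; under the classical axioms of boolp every proper (resp. prime)
   ideal is of this form. *)

(* A strictly increasing chain P_0 < P_1 < ... < P_d of prime ideals. *)
Definition has_prime_chain (A : comNzRingType) (d : nat) : Prop :=
  exists P : 'I_d.+1 -> prime_idealr A,
    forall i j : 'I_d.+1, (i < j)%N ->
      {subset P i <= P j} /\ ~ {subset P j <= P i}.

Definition krull_dim (A : comNzRingType) (d : nat) : Prop :=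
  has_prime_chain A d /\ forall e : nat, has_prime_chain A e -> (e <= d)%N.

Definition homogeneous_ideal (k : fieldType) (n : nat)
    (I : idealr {mpoly k[n]}) : Prop :=
  forall (f : {mpoly k[n]}) (d : nat), f \in I -> pihomog mdeg d f \in I.

(* The map k[Y_1, ..., Y_D] -> k[x_1, ..., x_n] / I sending Y_i to the class
   of y_i. *)
Definition eval_quot (k : fieldType) (n D : nat) (I : idealr {mpoly k[n]})
    (y : D.-tuple {mpoly k[n]}) (a : {mpoly k[D]}) : {ideal_quot I} :=
  \pi_{ideal_quot I} (a \mPo y).

Definition module_finite (k : fieldType) (n D : nat) (I : idealr {mpoly k[n]})
    (y : D.-tuple {mpoly k[n]}) : Prop :=
  exists (m : nat) (s : 'I_m -> {ideal_quot I}),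
    forall r : {ideal_quot I}, exists c : 'I_m -> {mpoly k[D]},
      r = \sum_(i < m) eval_quot I y (c i) * s i.

(* As the source of eval_quot is a polynomial ring in D variables, injectivity
   says both that the y_i are algebraically independent and that their
   subalgebra meets I trivially. *)
Definition noether_normalisation (k : fieldType) (n D : nat)
    (I : idealr {mpoly k[n]}) (y : D.-tuple {mpoly k[n]}) : Prop :=
  [/\ forall i : 'I_D, tnth y i \is 1.-homog,
      injective (eval_quot I y)
    & module_finite I y].

Definition ideal_add (k : fieldType) (n D : nat) (I : idealr {mpoly k[n]})
    (y : D.-tuple {mpoly k[n]}) : set {mpoly k[n]} :=
  [set f | exists (g : {mpoly k[n]}) (c : 'I_D -> {mpoly k[n]}),
     g \in I /\ f = g + \sum_(i < D) c i * tnth y i].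

(* D is meant to be the Krull dimension of the quotient by I. *)
Definition minimal_reduction (k : fieldType) (n D : nat)
    (I : idealr {mpoly k[n]}) (J : set {mpoly k[n]}) : Prop :=
  exists y : D.-tuple {mpoly k[n]},
    noether_normalisation I y /\ J = ideal_add I y.

(* The degree q component of k[x_1, ..., x_n] / J, i.e. the image of the forms
   of degree q, is nonzero. *)
Definition quot_degree_neq0 (k : fieldType) (n : nat)
    (J : set {mpoly k[n]}) (q : nat) : Prop :=
  exists f : {mpoly k[n]}, f \is q.-homog /\ ~ J f.

Definition reduction_number (k : fieldType) (n : nat)
    (J : set {mpoly k[n]}) (q : nat) : Prop :=
  quot_degree_neq0 J q /\
  forall q' : nat, quot_degree_neq0 J q' -> (q' <= q)%N.

Definition rSet (k : fieldType) (n D : nat) (I : idealr {mpoly k[n]}) :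
    set nat :=
  [set q | exists J : set {mpoly k[n]},
     minimal_reduction D I J /\ reduction_number J q].

(* Main.v *)
Require Import Defs.
From HB Require Import structures.
From mathcomp Require Import all_boot all_order all_algebra.
From mathcomp Require Import boolp classical_sets cardinality.
From mathcomp Require Import mpoly.

(** Write J_y for the ideal generated by I and the linear forms
    y_1, ..., y_D.  A tuple y is determined by its D * n coefficients, so it is
    a point of an affine space over k.  Let U_q be the set of those y for which
    J_y contains every form of degree q.

    The set U_(q+1) is Zariski open: if y0 lies in it, every monomial of degree
    q+1 has an expression g + sum_i c_i y0_i with g in I; keeping g and the c_i
    while y varies gives as many forms of degree q+1 as there are monomials,
    and as soon as the determinant of their coefficients is nonzero at y they
    span all forms of degree q+1, inside J_y (quot_degree_eq0_open).  The sets
    U_q also increase with q (quot_degree_neq0_le), and y has reduction number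
    r exactly when it enters the chain at U_(r+1).  As affine space is a
    Noetherian topological space, the chain of the U_q is stationary, so the
    reduction numbers are bounded.

    Noetherianity is used in the following form (zariski_noetherian): there is
    no sequence of points y_0, y_1, ... such that each y_N is separated from
    all later points by a polynomial that vanishes at the later points but not
    at y_N.  It follows from Dickson's lemma: choose each separating polynomial
    with the smallest possible leading monomial; one of these leading monomials
    divides a later one, and cancelling leading terms produces a smaller
    separating polynomial.  Unbounded reduction numbers would give such a
    sequence of points. *)

Set Implicit Arguments.
Unset Strict Implicit.
Unset Printing Implicit Defensive.

Import Order.TTheory GRing.Theory.
Local Open Scope ring_scope.

(** * Dickson's lemma *)

(** Any tail of u has a least value; phi jumps from each index to a place
    where the least value of the remaining tail is attained, and least values
    of shrinking tails can only grow. *)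
Lemma monotone_subsequence (u : nat -> nat) :
  exists2 phi : nat -> nat,
    {homo phi : i j / (i < j)%N} & {homo u \o phi : i j / (i <= j)%N}.
Proof.
have argmin N : exists j, (N <= j)%N /\ forall i, (N <= i)%N -> (u j <= u i)%N.
  have exv : exists v, `[< exists2 j, (N <= j)%N & u j = v >].
    by exists (u N); apply/asboolP; exists N.
  case: (ex_minnP exv) => v /asboolP[j Nj <-] minv.
  by exists j; split=> // i Ni; apply: minv; apply/asboolP; exists i.
have [g gP] := choice argmin.
pose phi := fix phi a := if a is b.+1 then g (phi b).+1 else g 0%N.
exists phi.
  by apply: (homo_ltn ltn_trans) => a /=; have [] := gP (phi a).+1.
apply: (@homo_leq _ (u \o phi) leq leqnn leq_trans) => a /=.
case: a => [|a].
  by have [_ min] := gP 0%N; exact: min.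
have [_ min] := gP (phi a).+1; apply: min.
have [h _] := gP (phi a).+1; have [h' _] := gP (phi a.+1).+1.
exact: leq_trans h (ltnW h').
Qed.

(** Monotone subsequences are extracted for one variable after the other; in the
    resulting subsequence any two terms are comparable. *)
Lemma dickson n (u : nat -> 'X_{1..n}) :
  exists i j, (i < j)%N /\ (u i <= u j)%MM.
Proof.
suff [phi phiS phiU] : exists2 phi : nat -> nat,
    {homo phi : i j / (i < j)%N} &
    forall c, c \in enum 'I_n ->
      {homo (fun a => u (phi a) c) : i j / (i <= j)%N}.
  exists (phi 0%N), (phi 1%N); split; first exact: phiS.
  by apply/mnm_lepP => c; apply: phiU; rewrite ?mem_enum.
elim: (enum 'I_n) => [|c s [phi phiS phiU]]; first by exists id.
have [psi psiS psiU] := monotone_subsequence (fun a => u (phi a) c).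
exists (phi \o psi) => [i j /psiS/phiS//|d].
rewrite inE => /predU1P[-> //|ds] i j ij; apply: phiU => //.
by move: ij; rewrite leq_eqVlt => /predU1P[->//|/psiS/ltnW].
Qed.

(** * Affine space is a Noetherian topological space *)

(** The two scaled terms of h have the same leading monomial and the same
    leading coefficient.  Scaling by both leading coefficients, instead of
    dividing by one of them, keeps the statement valid over a domain. *)
Lemma cancel_lead (F : idomainType) m (f g : {mpoly F[m]})
    (h := mleadc f *: g - mleadc g *: 'X_[mlead g - mlead f] * f) :
  f != 0 -> (mlead f <= mlead g)%MM -> h != 0 -> (mlead h < mlead g)%O.
Proof.
move=> f0 le_fg h0; have [g0|g0] := eqVneq g 0.
  by move: h0; rewrite /h g0 mleadc0 scaler0 scale0r mul0r subr0 eqxx.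
have fc0 : mleadc f != 0 by rewrite mleadc_eq0.
have gc0 : mleadc g != 0 by rewrite mleadc_eq0.
have lg : mlead (mleadc f *: g) = mlead g by rewrite mleadZ.
have lf : mlead (mleadc g *: 'X_[mlead g - mlead f] * f) = mlead g.
  rewrite -scalerAl mleadZ // mleadM ?mleadXm ?submK //.
  by rewrite -msupp_eq0 msuppX.
have le_h : (mlead h <= mlead g)%O.
  by apply: (le_trans (mleadB_le _ _)); rewrite lg lf joinxx.
rewrite lt_neqAle le_h andbT; apply/negP => /eqP eq_h.
have : h@_(mlead h) == 0; last by rewrite mleadc_eq0 (negPf h0).
rewrite eq_h mcoeffB mcoeffZ -scalerAl mcoeffZ mulrC [_ * f]mulrC.
have -> : (f * 'X_[mlead g - mlead f])@_(mlead g) = mleadc f.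
  by rewrite -[X in _@_X](submK le_fg) mcoeffMX.
by rewrite subrr.
Qed.

(** If the open set on which f_N does not vanish contains y_N but none of the
    later points, then the union of the first N such open sets increases
    strictly with N: this is the ascending chain condition on open sets. *)
Lemma zariski_noetherian (F : idomainType) m (y : nat -> 'I_m -> F) :
  ~ forall N, exists f : {mpoly F[m]},
      f.@[y N] != 0 /\ forall M, (N < M)%N -> f.@[y M] = 0.
Proof.
pose sep N (f : {mpoly F[m]}) :=
  f.@[y N] != 0 /\ forall M, (N < M)%N -> f.@[y M] = 0.
move=> ex_sep.
have ex_min N : exists f, sep N f /\
    forall g, sep N g -> ~~ (mlead g < mlead f)%O.
  have [f0 sepf0] := ex_sep N; move: {2}(mlead f0) (erefl (mlead f0)) => l.
  elim/(well_founded_ind (@ltom_wf m)): l f0 sepf0 => l IH f sepf lf.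
  have [[g [sepg lt_g]]|nog] := pselect (exists g, sep N g /\ (mlead g < l)%O).
    exact: IH lt_g _ sepg erefl.
  exists f; split=> // g sepg; apply/negP => lt_g; apply: nog.
  by exists g; rewrite -lf.
have [f fP] := choice ex_min.
have [i [j [ltij le_ij]]] := dickson (fun N => mlead (f N)).
have [[fi_neq0 fi_eq0] _] := fP i; have [[fj_neq0 fj_eq0] minj] := fP j.
have nz N g : sep N g -> g != 0.
  by case=> + _; apply: contra_neq => ->; rewrite meval0.
have fi0 : f i != 0 by apply: (nz i).
pose h := mleadc (f i) *: f j -
  mleadc (f j) *: 'X_[mlead (f j) - mlead (f i)] * f i.
(* The polynomial f i vanishes at y j and at all later points, so at these
   points h has the same values as f j up to a nonzero constant. *)
have seph : sep j h.
  split=> [|M ltjM]; rewrite mevalB mevalM mevalZ fi_eq0 ?mulr0 ?subr0 //.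
  - by rewrite mulf_neq0 // mleadc_eq0.
  - by rewrite fj_eq0 // mulr0.
  - exact: ltn_trans ltjM.
by have := minj h seph; rewrite cancel_lead // (nz _ _ seph).
Qed.

(** * Forms and their coefficients *)

Definition monomials n q : seq 'X_{1..n} :=
  [seq val m | m <- enum {: 'X_{1..n < q.+1}} & mdeg (val m) == q].

Lemma mem_monomials n q (m : 'X_{1..n}) : (m \in monomials n q) = (mdeg m == q).
Proof.
apply/mapP/idP => [[b]|mq]; first by rewrite mem_filter => /andP[+ _] ->.
have lt_mq : (mdeg m < q.+1)%N by rewrite (eqP mq).
by exists (BMultinom lt_mq); rewrite // mem_filter mq mem_enum.
Qed.

Lemma monomials_uniq n q : uniq (monomials n q).
Proof.
rewrite map_inj_uniq => [|a b /val_inj //]; exact/filter_uniq/enum_uniq.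
Qed.

Lemma homog_monomialsE (R : nzRingType) n q (p : {mpoly R[n]}) :
  p \is q.-homog -> p = \sum_(m <- monomials n q) p@_m *: 'X_[m].
Proof.
move=> hp; apply/mpolyP => m; rewrite raddf_sum /=.
have [mq|mq] := boolP (m \in monomials n q); last first.
  rewrite (dhomog_nemf_coeff hp) -?mem_monomials // big_seq big1 // => m' m'q.
  rewrite mcoeffZ mcoeffX; case: eqP => [mm|_]; last by rewrite mulr0.
  by rewrite -mm m'q in mq.
rewrite (bigD1_seq m) ?monomials_uniq //= mcoeffZ mcoeffX eqxx mulr1.
rewrite big1 ?addr0 // => m' /negPf m'm.
by rewrite mcoeffZ mcoeffX m'm mulr0.
Qed.

Lemma linear_formE (R : nzRingType) n (p : {mpoly R[n]}) :
  p \is 1.-homog -> p = \sum_(v < n) p@_U_(v) *: 'X_v.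
Proof.
move=> hp; apply/mpolyP => m; rewrite raddf_sum /=.
have [/eqP|m1] := boolP (mdeg m == 1%N).
  move/eqP; rewrite mdeg_eq1 => /existsP[v /eqP->].
  rewrite (bigD1 v) //= mcoeffZ mcoeffX eqxx mulr1 big1 ?addr0 // => w wv.
  by rewrite mcoeffZ mcoeffX eq_mnm1 (negPf wv) mulr0.
rewrite (dhomog_nemf_coeff hp m1) big1 // => v _.
rewrite mcoeffZ mcoeffX; case: eqP => [mm|_]; last by rewrite mulr0.
by rewrite -mm mdeg1 in m1.
Qed.

Lemma pihomogMr (R : comNzRingType) n d q (c y : {mpoly R[n]}) :
  y \is d.-homog -> pihomog mdeg (q + d) (c * y) = pihomog mdeg q c * y.
Proof.
move=> hy; rewrite {1}[c]mpolyE mulr_suml raddf_sum /= [in RHS]pihomogE.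
rewrite [in RHS]big_mkcond mulr_suml /=; apply: eq_bigr => m _.
rewrite -scalerAl linearZ /=.
have hmy : 'X_[m] * y \is (mdeg m + d).-homog.
  by apply: dhomogM; rewrite ?dhomogX.
have [<-|mq] := eqVneq; first by rewrite pihomog_dE ?scalerAl.
by rewrite (pihomog_ne0 _ hmy) ?eqn_add2r // scaler0 mul0r.
Qed.

(** * The ideals generated by I and linear forms *)

Section ReductionIdeal.
Variables (k : fieldType) (n D : nat) (I : idealr {mpoly k[n]}).
Implicit Types (y : D.-tuple {mpoly k[n]}) (f g : {mpoly k[n]}).

Lemma ideal_addD y f g : ideal_add I y f -> ideal_add I y g ->
  ideal_add I y (f + g).
Proof.
move=> [a [c [aI ->]]] [b [e [bI ->]]].
exists (a + b), (fun i => c i + e i); split; first exact: rpredD.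
rewrite addrACA -big_split; congr (_ + _).
by apply: eq_bigr => i _; rewrite mulrDl.
Qed.

Lemma ideal_addMl y a f : ideal_add I y f -> ideal_add I y (a * f).
Proof.
move=> [b [c [bI ->]]]; exists (a * b), (fun i => a * c i).
split; first exact: idealMr.
rewrite mulrDr mulr_sumr; congr (_ + _).
by apply: eq_bigr => i _; rewrite mulrA.
Qed.

Lemma ideal_add0 y : ideal_add I y 0.
Proof.
exists 0, (fun=> 0); split; first exact: idealr0.
by rewrite add0r big1 // => i _; rewrite mul0r.
Qed.

Lemma ideal_add_sum y (T : eqType) (r : seq T) (F : T -> {mpoly k[n]}) :
  (forall t, t \in r -> ideal_add I y (F t)) ->
  ideal_add I y (\sum_(t <- r) F t).
Proof.
move=> hF; rewrite big_seq; elim/big_ind: _ => //.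
- exact: ideal_add0.
- exact: ideal_addD.
Qed.

Lemma monomial_ideal_add_homog y q :
  (forall m, mdeg m = q -> ideal_add I y 'X_[m]) ->
  forall f, f \is q.-homog -> ideal_add I y f.
Proof.
move=> hm f /homog_monomialsE ->; apply: ideal_add_sum => m.
by rewrite mem_monomials => /eqP /hm; rewrite -mul_mpolyC; exact: ideal_addMl.
Qed.

(** Contrapositive reading: a monomial of degree q+1 is a variable times a
    monomial of degree q, so an ideal containing all forms of one degree
    contains all forms of every higher degree. *)
Lemma quot_degree_neq0_le y p q : (p <= q)%N ->
  quot_degree_neq0 (ideal_add I y) q -> quot_degree_neq0 (ideal_add I y) p.
Proof.
elim: q => [|q IH]; first by rewrite leqn0 => /eqP->.
rewrite leq_eqVlt => /predU1P[-> //|/IH{}IH] [f [hf nf]]; apply: IH.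
apply: contra_notP nf => Jq; apply: monomial_ideal_add_homog hf => m mq.
have [i mi] : exists i, m i != 0%N.
  apply/existsP; apply: contra_eqT mq => /existsPn m0.
  by rewrite mdegE big1 // => i _; apply/eqP/negPn/m0.
have le_im : (U_(i) <= m)%MM by rewrite lep1mP.
rewrite -(submK le_im) addmC mpolyXD; apply: ideal_addMl; apply: contrapT => nJ.
apply: Jq; exists 'X_[m - U_(i)]; split=> //; rewrite dhomogX.
by rewrite -(eqn_add2r 1) -[X in (_ + X)%N](mdeg1 i) -mdegD (submK le_im) mq
  addn1.
Qed.

(** Because I and the y_i are homogeneous, taking homogeneous components in any
    expression of f leaves an expression of f by forms. *)
Lemma homog_ideal_add y q f : homogeneous_ideal I ->
    (forall i, tnth y i \is 1.-homog) ->
    f \is q.+1.-homog -> ideal_add I y f ->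
  exists g (c : 'I_D -> {mpoly k[n]}),
    [/\ g \in I, g \is q.+1.-homog, forall i, c i \is q.-homog
      & f = g + \sum_(i < D) c i * tnth y i].
Proof.
move=> hI hy hf [g [c [gI fE]]].
exists (pihomog mdeg q.+1 g), (fun i => pihomog mdeg q (c i)); split.
- exact: hI.
- exact: pihomogP.
- by move=> i; exact: pihomogP.
rewrite -{1}(pihomog_dE hf) fE raddfD raddf_sum /=; congr (_ + _).
by apply: eq_bigr => i _; rewrite -addn1 pihomogMr.
Qed.

(** The coefficients of the linear forms y_i, flattened into one point of affine
    space of dimension D * n. *)
Definition coordinates y (e : 'I_#|{: 'I_D * 'I_n}|) : k :=
  let: (i, v) := enum_val e in (tnth y i)@_U_(v).

(** The condition that the quotient vanishes in degree q+1 is open in y: the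
    polynomial P is the determinant, as a function of y, of the coefficients of
    the forms h y j obtained by deforming expressions of the monomials at y0. *)
Lemma quot_degree_eq0_open y0 q : homogeneous_ideal I ->
    (forall i, tnth y0 i \is 1.-homog) ->
    ~ quot_degree_neq0 (ideal_add I y0) q.+1 ->
  exists P : {mpoly k[#|{: 'I_D * 'I_n}|]}, P.@[coordinates y0] != 0 /\
    forall y, (forall i, tnth y i \is 1.-homog) ->
      quot_degree_neq0 (ideal_add I y) q.+1 -> P.@[coordinates y] = 0.
Proof.
move=> hI hy0 full.
pose s := monomials n q.+1.
pose mon (j : 'I_(size s)) : 'X_{1..n} := tnth (in_tuple s) j.
have mon_deg j : mdeg (mon j) = q.+1.
  by apply/eqP; rewrite -mem_monomials mem_tnth.
have /choice[gc gcP] (j : 'I_(size s)) :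
    exists gc : {mpoly k[n]} * ('I_D -> {mpoly k[n]}),
      [/\ gc.1 \in I, gc.1 \is q.+1.-homog, forall i, gc.2 i \is q.-homog
        & 'X_[mon j] = gc.1 + \sum_(i < D) gc.2 i * tnth y0 i].
  have [||g [c ?]] := @homog_ideal_add y0 q 'X_[mon j] hI hy0.
  - by rewrite dhomogX; apply/eqP/mon_deg.
  - apply: contrapT => nJ; apply: full; exists 'X_[mon j]; split=> //.
    by rewrite dhomogX; apply/eqP/mon_deg.
  - by exists (g, c).
(* h y0 j is the monomial mon j, so that A y0 below is the identity matrix.
   The entries of G are polynomials in the coordinates of y; evaluation at
   the coordinates of y turns G into A y. *)
pose h y j := (gc j).1 + \sum_(i < D) (gc j).2 i * tnth y i.
pose A y := \matrix_(j, l) (h y j)@_(mon l).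
pose G := \matrix_(j, l) (((gc j).1)@_(mon l))%:MP_[#|{: 'I_D * 'I_n}|] +
  \matrix_(j, l) \sum_(i < D) \sum_(v < n)
     (((gc j).2 i * 'X_v)@_(mon l) *: 'X_(enum_rank (i, v))).
have GE y : (forall i, tnth y i \is 1.-homog) ->
    (\det G).@[coordinates y] = \det (A y).
  move=> hy; rewrite -det_map_mx; congr determinant; apply/matrixP => j l.
  rewrite !mxE raddfD /= mevalC mcoeffD; congr (_ + _).
  rewrite !raddf_sum /=; apply: eq_bigr => i _.
  rewrite [in RHS](linear_formE (hy i)) mulr_sumr !raddf_sum /=.
  apply: eq_bigr => v _; rewrite mevalZ mevalXU /coordinates enum_rankK.
  by rewrite -scalerAr mcoeffZ mulrC.
exists (\det G); split.
  rewrite GE // (_ : A y0 = 1%:M) ?det1 ?oner_neq0 //.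
  apply/matrixP => j l; rewrite !mxE /h; have [_ _ _ <-] := gcP j.
  rewrite mcoeffX; congr (nat_of_bool _)%:R; apply/eqP/eqP => [|->//].
  rewrite /mon !(tnth_nth 0%MM) => /eqP.
  by rewrite nth_uniq ?monomials_uniq ?ltn_ord // => /eqP/val_inj.
move=> y hy [f [hf nf]]; rewrite GE //; apply: contra_notP nf => /eqP detA.
have hh j : h y j \is q.+1.-homog.
  have [_ hg hc _] := gcP j; apply: rpredD => //; apply: rpred_sum => i _.
  by rewrite -addn1; exact: dhomogM.
have hJ j : ideal_add I y (h y j).
  by have [gI _ _ _] := gcP j; exists (gc j).1, (gc j).2.
have hE j : h y j = \sum_l A y j l *: 'X_[mon l].
  rewrite {1}(homog_monomialsE (hh j)) -/s big_tnth.
  by apply: eq_bigr => l _; rewrite mxE.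
apply: monomial_ideal_add_homog hf => m mq.
have /tnthP[l ->] : m \in in_tuple s by rewrite mem_monomials mq.
have uA : A y \in unitmx by rewrite unitmxE unitfE.
(* Inverting A y expresses each monomial through the h y j, which lie in J_y. *)
have -> : 'X_[tnth (in_tuple s) l] = \sum_j invmx (A y) l j *: h y j.
  transitivity (\sum_i (invmx (A y) *m A y) l i *: 'X_[k, mon i]).
    rewrite mulVmx // (bigD1 l) //= mxE eqxx scale1r big1 ?addr0 // => i il.
    by rewrite mxE eq_sym (negPf il) scale0r.
  under [RHS]eq_bigr do rewrite hE scaler_sumr.
  rewrite exchange_big; apply: eq_bigr => i _; rewrite mxE scaler_suml.
  by apply: eq_bigr => j _; rewrite scalerA.
apply: ideal_add_sum => j _; rewrite -mul_mpolyC; exact/ideal_addMl/hJ.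
Qed.

End ReductionIdeal.

(** * Finiteness of the reduction number set *)

Theorem theorem6p2 (k : fieldType) (hk : infinite_set [set: k]%classic)
    (n D : nat) (I : idealr {mpoly k[n]})
    (hI : homogeneous_ideal I)
    (hD : krull_dim {ideal_quot I} D) :
  finite_set (rSet D I).
Proof.
have [[N bound]|unbounded] :=
  pselect (exists N, forall q, rSet D I q -> (q < N)%N).
  exact: sub_finite_set bound (finite_II N).
have /choice[g gP] N : exists q, rSet D I q /\ (N <= q)%N.
  apply: contrapT => none; apply: unbounded; exists N => q rq.
  by rewrite ltnNge; apply/negP => leNq; apply: none; exists q.
(* A strictly increasing sequence of reduction numbers, with witnesses y: the
   point y a is in U_(r a + 1), and no later point of the sequence is. *)
pose r := fix r a := g (if a is b.+1 then (r b).+1 else 0%N).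
have rS : {homo r : a b / (a < b)%N}.
  by apply: (homo_ltn ltn_trans) => a /=; have [] := gP (r a).+1.
have /choice[y yP] a : exists y : D.-tuple {mpoly k[n]},
    (forall i, tnth y i \is 1.-homog) /\ reduction_number (ideal_add I y) (r a).
  have [J [[y [[hy _ _] ->]] red]] : rSet D I (r a).
    by case: a => [|a]; [case: (gP 0%N) | case: (gP (r a).+1)].
  by exists y.
case: (@zariski_noetherian k _ (fun a => coordinates (y a))) => N.
have [hyN [_ maxN]] := yP N.
have [|P [PN PM]] := @quot_degree_eq0_open k n D I (y N) (r N) hI hyN.
  by move=> /maxN; rewrite ltnn.
exists P; split=> // M ltNM; have [hyM [neqM _]] := yP M.
by apply: PM => //; apply: quot_degree_neq0_le neqM; exact: rS.
Qed.
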